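(* There exist a countably compact space $X$ and a Lindelöf space $Y$ whose product $X\times Y$ is not star Menger.
   Context: All spaces are assumed to be regular and $T_1$. For a family $\mathcal{U}$ of subsets of $X$ and $A\subseteq X$, $St(A,\mathcal{U})=\bigcup\{U\in\mathcal{U}:U\cap A\neq\emptyset\}$. A space $M$ is Menger if for every sequence $\{\mathcal{U}_n:n\in\omega\}$ of open covers of $M$ there are finite subcollections $\mathcal{V}_n\subseteq\mathcal{U}_n$ ($n\in\omega$) such that $\bigcup\{\mathcal{V}_n:n\in\omega\}$ is an open cover of $M$. A space $X$ is star Menger if for every open cover $\mathcal{U}$ of $X$ there is a subspace $M\subseteq X$ which is Menger and satisfies $St(M,\mathcal{U})=X$. *)

(* Defs.v *)
From mathcomp Require Import all_boot all_order all_classical all_reals all_analysis.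

Set Implicit Arguments.
Unset Strict Implicit.
Unset Printing Implicit Defensive.

Local Open Scope classical_set_scope.

Definition open_cover (T : topologicalType) (U : set (set T)) : Prop :=
  U `<=` open /\ cover U id = [set: T].

Definition star (T : Type) (A : set T) (U : set (set T)) : set T :=
  \bigcup_(B in [set B | U B /\ B `&` A !=set0]) B.

Definition countably_compact (T : topologicalType) : Prop :=
  forall U : set (set T), countable U -> open_cover U ->
    exists V : set (set T), [/\ V `<=` U, finite_set V & open_cover V].

Definition lindelof (T : topologicalType) : Prop :=
  forall U : set (set T), open_cover U ->
    exists V : set (set T), [/\ V `<=` U, countable V & open_cover V].

Definition menger (T : topologicalType) : Prop :=
  forall U : nat -> set (set T), (forall n, open_cover (U n)) ->
    exists V : nat -> set (set T),
      (forall n, V n `<=` U n /\ finite_set (V n)) /\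
      open_cover (\bigcup_n V n).

(* [set_type M] carries the initial topology of its inclusion into [T], which
   is the subspace topology; the library's [subspace M] is a different object
   (a retopologization of the whole of [T]). *)
Definition star_menger (T : topologicalType) : Prop :=
  forall U : set (set T), open_cover U ->
    exists M : set T, menger (set_type M) /\ star M U = [set: T].

(* The blanket convention that spaces are regular and T1. *)
Definition regular_T1 (T : topologicalType) : Prop :=
  regular_space T /\ accessible_space T.

(* Main.v *)
(* [X] is the ordinal omega_1 with its order topology, and [Y] is the discrete
   space omega_1 with one point added whose neighbourhoods are the co-countable
   sets containing it. The sets [0, a] x [a, oo] and V_a = ]a, omega_1[ x {a}
   form an open cover of the product, and V_a is disjoint from every other
   member of it. If the star of [M] is everything, then [M] meets every V_a, so
   no countable subfamily of this cover covers [M]; thus [M] is not even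
   Lindelöf. *)
Require Import Defs.
From HB Require Import structures.
From mathcomp Require Import all_boot all_order all_classical all_reals all_analysis.
From mathcomp Require Import wochoice.

Set Implicit Arguments.
Unset Strict Implicit.
Unset Printing Implicit Defensive.

Local Open Scope classical_set_scope.

(** * Countable sets *)

Lemma countable_image (T U : Type) (f : T -> U) (A : set T) :
  countable A -> countable (f @` A).
Proof. exact/sub_countable/card_image_le. Qed.

Lemma countable_subset (T : Type) (A B : set T) :
  A `<=` B -> countable B -> countable A.
Proof. by move=> AB; apply/sub_countable/subset_card_le. Qed.

Lemma countable_setU (T : Type) (A B : set T) :
  countable A -> countable B -> countable (A `|` B).
Proof.
by move=> cA cB; rewrite -bigcup2E; apply: bigcup_countable => // -[|[|n]].
Qed.

Lemma uncountable_set_nat : ~ countable [set: set nat].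
Proof.
move=> /countable_injP[f f_inj].
(* Cantor's diagonal set, transported to [nat] along the injection [f]. *)
pose D := [set n | exists2 A, f A = n & ~ A n].
have [Df|nDf] := pselect (D (f D)); last by apply: (nDf); exists D.
by case: (Df) => A fA; rewrite (f_inj _ _ _ _ fA) ?inE.
Qed.

(** * Well-orders *)

Section WellOrder.
Variables (T : eqType) (R : rel T).
Hypothesis woR : well_order R.

Let woRT : wo_chain R predT. Proof. by move=> A _; exact: woR. Qed.

Lemma wo_total : total R.
Proof. by move=> x y; apply: (wo_chainW woRT). Qed.

Lemma wo_refl : reflexive R.
Proof. by move=> x; apply: (wo_chain_reflexive woRT). Qed.

Lemma wo_anti : antisymmetric R.
Proof. by move=> x y; apply: (wo_chain_antisymmetric woRT). Qed.

Lemma wo_minimum (A : set T) : A !=set0 -> exists2 z, A z & A `<=` R z.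
Proof.
move=> [x Ax]; have [|z [[Az zmin] _]] := @woR (mem A).
  by exists x; rewrite inE.
by exists z; [exact: set_mem|move=> y Ay; apply: zmin; rewrite inE].
Qed.

(** Look at the least element of {x, y, z}: if it is y or z, antisymmetry identifies it with the
    point before it. *)
Lemma wo_trans : transitive R.
Proof.
move=> y x z xy yz; have [|m] := @wo_minimum [set x; y; z]; first by exists x; left; left.
move=> [[|]|] -> min.
- by apply: min; right.
- have yx : R y x by apply: min; left; left.
  by rewrite (@wo_anti x y) ?xy.
- have zy : R z y by apply: min; left; right.
  by rewrite -(@wo_anti y z) ?yz.
Qed.

End WellOrder.

(** * The ordinal omega_1 *)

Lemma exists_omega1 : exists (T : choiceType) (R : rel T),
  [/\ well_order R, ~ countable [set: T]
    & forall x, countable [set y | R y x]].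
Proof.
have [R woR] := well_ordering_principle (set nat : eqType).
(* [D] is the initial part of a well-order of [set nat] that plays omega_1. Were it countable, the
   least point outside it would have only countably many predecessors, hence belong to it. *)
pose D := [set x | countable [set y | R y x]].
have Dunc : ~ countable D.
  move=> cD; have [|x /= nDx xmin] := @wo_minimum _ _ woR (~` D).
    apply: contrapT => /set0P/negP; rewrite negbK => /eqP D0.
    by apply: uncountable_set_nat; rewrite -(setCK D) D0 setC0 in cD.
  apply: nDx; apply: (@countable_subset _ _ (D `|` [set x])); last first.
    by apply: countable_setU => //; exact: countable1.
  move=> y /= yx; have [?|nDy] := pselect (D y); first by left.
  by right; apply: (wo_anti woR); rewrite yx xmin.
exists (set_type D), (fun x y => R (\val x) (\val y)); split.
- apply: antisymmetric_well_order => [x y /(wo_anti woR)|A [x xA]].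
    exact: val_inj.
  have [|_ [z /= zA <-] zmin] := @wo_minimum _ _ woR (set_val @` [set` A]).
    by exists (\val x), x.
  by exists z; split=> // y yA; apply: zmin; exists y.
- move=> /(countable_image set_val) cD; apply: Dunc.
  by apply: countable_subset cD => x Dx; exists (SigSub (mem_set Dx)).
- move=> x; have /countable_injP[f f_inj] : D (\val x) by exact: set_valP.
  apply/countable_injP; exists (f \o \val) => y z; rewrite !inE => yx zx /f_inj.
  by rewrite !inE => /(_ yx zx) /val_inj.
Qed.

Lemma regular_clopen (T : topologicalType) :
  (forall (x : T) (A : set T), open A -> A x ->
    exists B, [/\ clopen B, B x & B `<=` A]) ->
  regular_space T.
Proof.
move=> base x A; rewrite {1}nbhsE => -[V [oV Vx] VA].
have [B [[oB cB] Bx BV]] := base x V oV Vx.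
exists B; first by apply: open_nbhs_nbhs.
by rewrite -(iffLR (closure_id B)) //; exact: subset_trans VA.
Qed.

(** * The order topology on a well-order *)

Definition wo_topology (T : choiceType) (R : rel T) (woR : well_order R) : Type := T.

Section WoTopology.
Variables (T : choiceType) (R : rel T).
Hypothesis woR : well_order R.

(* [None] stands for an endpoint below every point, so that ]a, x] ranges over
   all basic neighbourhoods of x, including those of the least point. *)
Definition wo_above (a : option T) : set T :=
  [set y | if a is Some b then ~~ R y b else true].

(** This is the order topology: a point x of a well-order is last or has an immediate successor, so
    intervals ]a, x] closed at x are open. *)
Definition wo_open (A : set T) :=
  forall x, A x -> exists2 a, wo_above a x & wo_above a `&` R^~ x `<=` A.

Lemma wo_openT : wo_open setT.
Proof. by move=> x _; exists None. Qed.

Lemma wo_above_total (a b : option T) :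
  wo_above a `<=` wo_above b \/ wo_above b `<=` wo_above a.
Proof.
case: a b => [a|] [b|]; [|by left|by right|by left].
by have /orP[ab|ba] := wo_total woR a b; [right|left] => x /=;
  apply: contra => xa; apply: wo_trans xa _.
Qed.

Lemma wo_openI : setI_closed wo_open.
Proof.
move=> A B oA oB x [Ax Bx].
have [a ax aA] := oA _ Ax; have [b bx bB] := oB _ Bx.
have [ab|ba] := wo_above_total a b.
- by exists a => // y [ya yx]; split; [apply: aA|apply: bB; split=> //; apply: ab].
- by exists b => // y [yb yx]; split; [apply: aA; split=> //; apply: ba|apply: bB].
Qed.

Lemma wo_open_bigU (I : Type) (f : I -> set T) :
  (forall i, wo_open (f i)) -> wo_open (\bigcup_i f i).
Proof.
move=> of_ x [i _ fix_]; have [a ax af] := of_ i _ fix_.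
by exists a => // y /af; exists i.
Qed.

HB.instance Definition _ := Choice.on (wo_topology woR).
HB.instance Definition _ :=
  isOpenTopological.Build (wo_topology woR) wo_openT wo_openI wo_open_bigU.

Local Notation X := (wo_topology woR).

Lemma wo_openE : (open : set (set X)) = wo_open.
Proof. by []. Qed.

Lemma wo_open_above (a : option T) : open (wo_above a : set X).
Proof. by rewrite wo_openE => x ax; exists a => // y []. Qed.

Lemma wo_open_le (x : T) : open ([set y | R y x] : set X).
Proof.
by rewrite wo_openE => y yx; exists None => // z [_ zy]; exact: (wo_trans woR) zy yx.
Qed.

Lemma wo_clopen_above (a : option T) : clopen (wo_above a : set X).
Proof.
split; first exact: wo_open_above.
rewrite -openC; case: a => [a|].
- rewrite (_ : ~` _ = [set y | R y a]); first exact: wo_open_le.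
  by apply/seteqP; split=> y /=; [move/negP; rewrite negbK|move=> ->].
- rewrite (_ : ~` _ = set0); first exact: open0.
  by apply/seteqP; split=> // y [].
Qed.

Lemma wo_clopen_le (x : T) : clopen ([set y | R y x] : set X).
Proof.
split; first exact: wo_open_le.
rewrite -openC (_ : ~` _ = wo_above (Some x)); first exact: wo_open_above.
by apply/seteqP; split=> y /= /negP.
Qed.

Lemma wo_regular : regular_space X.
Proof.
apply: regular_clopen => x A oA Ax; have [a ax aA] := oA _ Ax.
exists (wo_above a `&` [set y | R y x]); split=> //.
- by apply: clopenI; [exact: wo_clopen_above|exact: wo_clopen_le].
- by split=> //; exact: wo_refl.
Qed.

Lemma wo_accessible : accessible_space X.
Proof.
move=> x y xy; have [yx|yx] := boolP (R y x).
- exists (wo_above (Some y)); rewrite !inE; split; first exact: wo_open_above.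
  + by apply: contra xy => xy; apply/eqP/(wo_anti woR)/andP.
  + by rewrite /= (wo_refl woR).
- exists [set z | R z x]; rewrite !inE; split; first exact: wo_open_le.
  + exact: wo_refl.
  + exact/negP.
Qed.

Hypothesis Tunc : ~ countable [set: T].
Hypothesis Tinit : forall x, countable [set y | R y x].

(** Were [A] cofinal, [T] would be a countable union of countable initial segments. *)
Lemma wo_bounded (A : set T) : countable A -> exists b, forall x, A x -> ~~ R b x.
Proof.
move=> cA; apply: contrapT => /forallNP nb; apply: Tunc.
apply: (@countable_subset _ _ (\bigcup_(x in A) [set y | R y x])).
  by move=> b _; have /existsNP[x /not_implyP[Ax /negP]] := nb b; rewrite negbK; exists x.
exact: bigcup_countable.
Qed.

(* If no finite part of the cover U_0, U_1, ... covers, choose x_n outside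
   U_0, ..., U_n; the least z such that x_n <= z for infinitely many n is an
   accumulation point of the sequence. *)
Lemma wo_countably_compact : countably_compact X.
Proof.
move=> U /countable_injP[g g_inj] [oU cU].
pose V n := U `&` [set B | g B < n.+1]%N.
have [[n cV]|/forallNP ncV] := pselect (exists n, cover (V n) id = [set: X]).
  exists (V n); split; first by move=> B [].
  - have -> : V n = set_val @` ((g \o (@set_val _ U)) @^-1` `I_n.+1).
      apply/seteqP; split=> [B [UB gB]|_ [B gB <-]].
        by exists (SigSub (mem_set UB)).
      by split=> //; exact: set_valP.
    apply: finite_image; apply: finite_preimage; last exact: finite_II.
    move=> A B _ _ /= /g_inj AB; apply: val_inj; apply: AB.
    + exact: valP.
    + exact: valP.
  - by split=> // B [/oU].
have {ncV} /choice[x xV] : forall n, exists x : X, ~ cover (V n) id x.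
  by move=> n; apply/existsNP => cV; apply: (ncV n); apply/seteqP; split=> // x _.
pose N z := [set n | R (x n) z].
have [|z Nz zmin] := @wo_minimum _ _ woR [set z | infinite_set (N z)].
  have [|b xb] := @wo_bounded (range x); first exact: countable_image.
  exists b => /=; rewrite (_ : N b = setT); first exact: infinite_nat.
  apply/seteqP; split=> // n _.
  have := xb (x n); have /orP[//|bx] := wo_total woR (x n) b.
  by rewrite bx => /(_ (ex_intro2 _ _ n I erefl)).
have [B UB Bz] : cover U id z by rewrite cU.
have [a az aB] := oU _ UB _ Bz.
(* For n >= [g B] the set [B] belongs to [V n], so x_n avoids it. *)
have {}Nz : infinite_set (N z `\` `I_(g B)).
  by apply: infinite_setD => //; exact: finite_II.
have out n : (N z `\` `I_(g B)) n -> ~ wo_above a (x n).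
  move=> [xz /= /negP]; rewrite -leqNgt => gn xa.
  by apply: (xV n); exists B => //; exact: aB.
(* If [a] is a point, infinitely many x_n are <= a, so minimality gives z <= a, against a < z. If it
   is [None], a single x_n <= z already lies in [B]. *)
case: a az aB out => [a|] az aB out.
- suff /zmin za : infinite_set (N a) by move: az; rewrite /= za.
  apply: sub_infinite_set Nz => n /out /= /negP.
  by rewrite negbK.
- have [n Nn] := infinite_setN0 Nz.
  by case: (out _ Nn).
Qed.

End WoTopology.

(** * The one-point Lindelöf extension of a discrete space *)

Definition lindelofication (T : Type) : Type := option T.

Section Lindelofication.
Variable T : choiceType.

Definition lindelofication_open (A : set (option T)) :=
  A None -> countable (~` A).

Lemma lindelofication_openT : lindelofication_open setT.
Proof. by move=> _; rewrite setCT. Qed.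

Lemma lindelofication_openI : setI_closed lindelofication_open.
Proof.
move=> A B oA oB [/oA cA /oB cB].
by rewrite setCI; exact: countable_setU.
Qed.

Lemma lindelofication_open_bigU (I : Type) (f : I -> set (option T)) :
  (forall i, lindelofication_open (f i)) -> lindelofication_open (\bigcup_i f i).
Proof.
move=> of_ [i _ /of_]; apply: countable_subset.
by apply: subsetC; exact: bigcup_sup.
Qed.

HB.instance Definition _ := Choice.on (lindelofication T).
HB.instance Definition _ := isOpenTopological.Build (lindelofication T)
  lindelofication_openT lindelofication_openI lindelofication_open_bigU.

Local Notation Y := (lindelofication T).

Lemma lindelofication_openE : (open : set (set Y)) = lindelofication_open.
Proof. by []. Qed.

Lemma lindelofication_regular : regular_space Y.
Proof.
apply: regular_clopen => -[x|] A oA Ax.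
- exists [set Some x]; split=> //; last by move=> _ ->.
  split; first by rewrite lindelofication_openE.
  by rewrite -openC lindelofication_openE => _; rewrite setCK; exact: countable1.
(* An open set containing [None] is also closed: its complement misses [None], so the openness
   condition on it is vacuous. *)
- by exists A; split=> //; split=> //; rewrite -openC lindelofication_openE => /(_ Ax).
Qed.

Lemma lindelofication_accessible : accessible_space Y.
Proof.
move=> x y xy; exists (~` [set y]); rewrite !inE; split.
- by rewrite lindelofication_openE => _; rewrite setCK; exact: countable1.
- exact/eqP.
- by rewrite setCK.
Qed.

(** A member of the cover containing [None] misses only countably many points; one further member
    for each of them suffices. *)
Lemma lindelofication_lindelof : lindelof Y.
Proof.
move=> U [oU cU].
have /choice[f fU] : forall y : Y, exists B, U B /\ B y.
  move=> y; have [B UB By] : cover U id y by rewrite cU.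
  by exists B.
exists (f @` (None |` ~` f None)); split.
- by move=> _ [y _ <-]; have [] := fU y.
- apply: countable_image; apply: countable_setU; first exact: countable1.
  by apply: (oU (f None)); have [] := fU None.
- split=> [_ [y _ <-]|]; first by apply: oU; have [] := fU y.
  apply/seteqP; split=> // y _; have [fy|fy] := pselect (f None y).
  + by exists (f None) => //; exists None => //; left.
  + by exists (f y); [exists y => //; right|have [] := fU y].
Qed.

End Lindelofication.

(** * From Menger subspaces to countable subcovers *)

Lemma menger_lindelof (T : topologicalType) : menger T -> lindelof T.
Proof.
move=> mT U cU; have [V [VU cV]] := mT (fun=> U) (fun=> cU).
exists (\bigcup_n V n); split=> //.
- by move=> B [n _ /(VU n).1].
- by apply: bigcup_countable => // n _; apply: finite_set_countable; exact: (VU n).2.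
Qed.

(** Moves from covers of the subspace to indexed families in the ambient space, so that indices can
    be counted: each trace kept in the subcover receives one index [h]. *)
Lemma lindelof_subcover (T : topologicalType) (M : set T) (I : Type)
    (f : I -> set T) :
  lindelof (set_type M) -> (forall i, open (f i)) -> M `<=` \bigcup_i f i ->
  exists2 J, countable J & M `<=` \bigcup_(i in J) f i.
Proof.
move=> lM of_ Mf; pose F i : set (set_type M) := set_val @^-1` f i.
have [|V [VF cV [_ VT]]] := lM (range F).
  split=> [_ [i _ <-]|]; first by exists (f i) => //; exact: of_.
  apply/seteqP; split=> // x _; have [i _ fix_] := Mf _ (set_valP x).
  by exists (F i).
have /choice[h hV] : forall B : V, exists i, F i = \val B.
  by case=> B /= /set_mem /VF[i _ <-]; exists i.
exists (range h); first by apply: countable_image; rewrite (eq_countable (card_setT V)).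
move=> x Mx.
have [B VB] : cover V id (SigSub (mem_set Mx) : set_type M) by rewrite VT.
rewrite -[B]/(\val (SigSub (mem_set VB) : V)) -hV => Bx.
by exists (h (SigSub (mem_set VB))); first exact: imageT.
Qed.

Lemma open_setX (T U : topologicalType) (A : set T) (B : set U) :
  open A -> open B -> open (A `*` B).
Proof.
move=> oA oB; rewrite openE => -[x y] [/= Ax By].
by exists (A, B) => //; split; apply: open_nbhs_nbhs.
Qed.

(** * The product and its bad cover *)

Section ProductNotStarMenger.
Variables (T : choiceType) (R : rel T).
Hypothesis woR : well_order R.
Hypothesis Tunc : ~ countable [set: T].
Hypothesis Tinit : forall x, countable [set y | R y x].

Local Notation X := (wo_topology woR).
Local Notation Y := (lindelofication T).

Definition wo_box (i : T + T) : set (X * Y) :=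
  match i with
  | inl a => [set x | R x a] `*` [set y | if y is Some b then R a b else true]
  | inr a => [set x | ~~ R x a] `*` [set Some a]
  end.

Lemma wo_box_open (i : T + T) : open (wo_box i).
Proof.
case: i => a /=; apply: open_setX.
- exact: wo_open_le.
- rewrite lindelofication_openE => _.
  (* The complement of [a, oo] lies in the countable initial segment up to a. *)
  apply: countable_subset (countable_image Some (Tinit a)).
  move=> [b|] //= /negP ab; exists b => //=.
  by have := wo_total woR a b; rewrite (negPf ab).
- exact: (@wo_open_above _ _ woR (Some a)).
- by rewrite lindelofication_openE.
Qed.

Lemma wo_box_cover : \bigcup_i wo_box i = setT.
Proof.
apply/seteqP; split=> // -[x [a|]] _.
- have [xa|xa] := boolP (R x a).
  + by exists (inl a) => //; split=> //=; exact: wo_refl.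
  + by exists (inr a) => //; split.
- by exists (inl x) => //; split=> //=; exact: wo_refl.
Qed.

(** A common point (x, a) with [0, b] x [b, oo] would give x <= b <= a, against a < x; two distinct
    V_a differ in their second coordinate. *)
Lemma wo_box_disjoint (a : T) (i : T + T) :
  wo_box (inr a) `&` wo_box i !=set0 -> i = inr a.
Proof.
case: i => b [[x y] [[/= xa ->] [/= xb]]]; last by move=> [->].
by move=> ba; move: xa; rewrite (wo_trans woR xb ba).
Qed.

Lemma wo_prod_not_star_menger : ~ star_menger (X * Y)%type.
Proof.
move=> /(_ (range wo_box))[|M [/menger_lindelof lM starM]].
  split=> [_ [i _ <-]|]; first exact: wo_box_open.
  by rewrite /cover bigcup_image; exact: wo_box_cover.
have meets a : M `&` wo_box (inr a) !=set0.
  (* A point x beyond a puts (x, a) in V_a. The star reaches (x, a) only through V_a itself, so [M]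
     meets V_a. *)
  have [x /(_ a erefl) xa] := wo_bounded Tunc Tinit (countable1 a).
  have : star M (range wo_box) (x, Some a) by rewrite starM.
  move=> [_ [[i _ <-] [p [pi Mp]]] ix].
  rewrite (@wo_box_disjoint a i) in pi; last by exists (x, Some a).
  by exists p.
have [|J cJ MJ] := lindelof_subcover lM wo_box_open; first by rewrite wo_box_cover.
have cK : countable (inr @^-1` J : set T).
  move: cJ => /countable_injP[f f_inj]; apply/countable_injP; exists (f \o inr).
  by move=> a b; rewrite !inE => Ja Jb /f_inj; rewrite !inE => /(_ Ja Jb)[].
(* Every [inr a] is in [J]: a point of [M] in V_a is covered by no other box. So all of [T] embeds
   in the countable [J]. *)
apply: Tunc; apply: countable_subset cK => a _.
have [p [Mp pa]] := meets a; have [i Ji pi] := MJ _ Mp.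
by rewrite /= -(@wo_box_disjoint a i) //; exists p.
Qed.

End ProductNotStarMenger.

Theorem proposition4p8 :
  exists X Y : topologicalType,
    [/\ regular_T1 X, regular_T1 Y, countably_compact X, lindelof Y
      & ~ star_menger (X * Y)%type].
Proof.
have [T [R [woR Tunc Tinit]]] := exists_omega1.
exists (wo_topology woR), (lindelofication T); split.
- by split; [exact: wo_regular|exact: wo_accessible].
- by split; [exact: lindelofication_regular|exact: lindelofication_accessible].
- exact: wo_countably_compact.
- exact: lindelofication_lindelof.
- exact: wo_prod_not_star_menger.
Qed.
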